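(* Let $R$ be a finite commutative Frobenius ring with unity, $|R|=\ell$, let $b,n\ge1$ and $1\le t\le b$ be integers, and let $C\subseteq R^{bn}$ be a byte error-control code (linear code) with byte length $b$. For $(j_1,\ldots,j_n)\in\{0,\ldots,b\}^n$ let $A(j_1,\ldots,j_n)$ be the number of codewords of $C$ with Hamming weight distribution vector $(j_1,\ldots,j_n)$. Then the split $m$-spotty Hamming weight enumerator of the dual code $C^\perp$ is $$S_{C^\perp}(x_i,y_i:i=1,\ldots,n)=\frac1{|C|}\sum_{(j_1,\ldots,j_n)}A(j_1,\ldots,j_n)\prod_{i=1}^n g^{(t)}_{j_i}(x_i,y_i),$$ where the sum runs over all $n$-tuples with $0\le j_i\le b$ for $1\le i\le n$, and $$g^{(t)}_{j_i}(x_i,y_i)=\sum_{p=0}^b K_p(j_i)\,x_i^{\lceil b/t\rceil-\lceil p/t\rceil}\,y_i^{\lceil p/t\rceil},\qquad K_p(j_i)=\sum_{a=0}^p(-1)^a(\ell-1)^{p-a}\binom{j_i}{a}\binom{b-j_i}{p-a},$$ with the convention $\binom ef=0$ when $f<0$ or $f>e$.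
   Context: A finite commutative ring $R$ is Frobenius if it is self-injective. A byte error-control code of length $bn$ and byte length $b$ is an $R$-submodule of $R^{bn}$; vectors are written $\mathbf u=(\mathbf u_1,\ldots,\mathbf u_n)$ with bytes $\mathbf u_i\in R^b$. $C^\perp$ is the dual with respect to the Euclidean inner product on $R^{bn}$. $w_H$ is the Hamming weight (number of nonzero coordinates), and for a byte $\mathbf u_i\in R^b$, $w_M(\mathbf u_i)=\lceil w_H(\mathbf u_i)/t\rceil$. In this statement the Hamming weight distribution vector of $\mathbf u$ is $(w_H(\mathbf u_1),\ldots,w_H(\mathbf u_n))$. The split $m$-spotty Hamming weight enumerator of a code $C$ is $$S_C(x_i,y_i:i=1,\ldots,n)=\sum_{(\mathbf u_1,\ldots,\mathbf u_n)\in C}\ \prod_{i=1}^n x_i^{\lceil b/t\rceil-w_M(\mathbf u_i)}\,y_i^{w_M(\mathbf u_i)}.$$ *)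

(* Defs.v *)
From HB Require Import structures.
From mathcomp Require Import all_boot all_order all_algebra.
From mathcomp Require Import mpoly.

Set Implicit Arguments.
Unset Strict Implicit.
Unset Printing Implicit Defensive.

Import GRing.Theory.
Local Open Scope ring_scope.

Definition injective_module (R : pzRingType) (E : lmodType R) : Prop :=
  forall (M N : lmodType R) (f : {linear M -> N}) (h : {linear M -> E}),
    injective f -> exists k : {linear N -> E}, forall m : M, k (f m) = h m.

Definition frobenius_ring (R : finComPzRingType) : Prop :=
  injective_module R^o.

Definition ceil_div (m d : nat) : nat := ((m + d.-1) %/ d)%N.

Definition hamming_weight (R : finComPzRingType) (b : nat) (u : 'rV[R]_b) : nat :=
  #|[set k : 'I_b | u 0 k != 0]|.

Definition mspotty_weight (R : finComPzRingType) (b t : nat) (u : 'rV[R]_b) : nat :=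
  ceil_div (hamming_weight u) t.

(* R^(bn) is represented by n x b matrices: the i-th byte of u is [row i u]. *)

Definition byte_code (R : finComPzRingType) (n b : nat)
    (C : {set 'M[R]_(n, b)}) : Prop :=
  GRing.submod_closed (mem C).

Definition inner_product (R : finComPzRingType) (n b : nat)
    (u v : 'M[R]_(n, b)) : R :=
  \sum_(i < n) \sum_(k < b) u i k * v i k.

Definition dual_code (R : finComPzRingType) (n b : nat)
    (C : {set 'M[R]_(n, b)}) : {set 'M[R]_(n, b)} :=
  [set v | [forall u in C, inner_product u v == 0]].

Definition weight_count (R : finComPzRingType) (n b : nat)
    (C : {set 'M[R]_(n, b)}) (j : {ffun 'I_n -> 'I_b.+1}) : nat :=
  #|[set u in C | [forall i : 'I_n, hamming_weight (row i u) == j i]]|.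

(* The 2n indeterminates are ordered x_1, ..., x_n, y_1, ..., y_n. *)
Definition xvar (n : nat) (i : 'I_n) : {mpoly rat[n + n]} := 'X_(lshift n i).
Definition yvar (n : nat) (i : 'I_n) : {mpoly rat[n + n]} := 'X_(rshift n i).

Definition split_enumerator (R : finComPzRingType) (n b t : nat)
    (C : {set 'M[R]_(n, b)}) : {mpoly rat[n + n]} :=
  \sum_(u in C) \prod_(i < n)
    (xvar i ^+ (ceil_div b t - mspotty_weight t (row i u))
     * yvar i ^+ mspotty_weight t (row i u)).

(* For j <= b the truncated subtractions p - a and b - j are exact, and
   'C(e, f) is 0 when f > e. *)
Definition krawtchouk (l b p j : nat) : int :=
  \sum_(0 <= a < p.+1)
    (-1) ^+ a * (l%:Z - 1) ^+ (p - a) * ('C(j, a))%:Z * ('C(b - j, p - a))%:Z.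

Definition g_poly (A : comNzRingType) (l b t j : nat) (x y : A) : A :=
  \sum_(0 <= p < b.+1)
    (krawtchouk l b p j)%:~R
      * x ^+ (ceil_div b t - ceil_div p t) * y ^+ ceil_div p t.

(* Main.v *)
(* No characters are needed.  Self-injectivity bounds the annihilator of a
   maximal ideal m by #|R / m|, so D |-> #|D| * #|D^perp| is nondecreasing on the
   submodules D of V = R^(bn); it equals #|V| both at 0 and at V, hence
   #|D| * #|D^perp| = #|V| for every D.  Applied to C + V_(~: S), with V_T the
   vectors supported in T, this gives
     #|C| * #|C^perp :&: V_S| = #|R| ^ #|S| * #|C :&: V_(~: S)|.
   Expanding products over coordinates into sums over sets S turns this into a
   MacWilliams identity for arbitrary coordinatewise product weights.  Summing it
   over all supports T yields the identity for byte weights, and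
   K_p(j) = sum_(#|T| = p) prod_(k in T) (if k in S then -1 else l - 1) for any
   S with #|S| = j. *)

Require Import Defs.
From HB Require Import structures.
From mathcomp Require Import all_boot all_order all_algebra.
From mathcomp Require Import mpoly.

Set Implicit Arguments.
Unset Strict Implicit.
Unset Printing Implicit Defensive.

Import GRing.Theory.
Local Open Scope ring_scope.

(** * Principal ideals and self-injectivity *)

Definition principal_ideal (R : finComPzRingType) (x : R) : {pred R^o} :=
  [pred y : R^o | [exists a : R, y == a * x]].

Lemma principal_ideal_closed (R : finComPzRingType) (x : R) :
  GRing.subsemimod_closed (principal_ideal x).
Proof.
split; first split; first by apply/existsP; exists 0; rewrite mul0r.
  move=> u v /existsP[a /eqP->] /existsP[c /eqP->].
  by apply/existsP; exists (a + c); rewrite mulrDl.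
move=> r u /existsP[a /eqP->].
by apply/existsP; exists (r * a); rewrite -mulrA.
Qed.

(** The ideal R x is made a type of its own so that its inclusion [val] into [R^o] is an injective
    linear map, the form of input that [injective_module] takes. *)
Record principal_module (R : finComPzRingType) (x : R) := PrincipalModule
  { principal_val : R^o; _ : principal_val \in principal_ideal x }.

HB.instance Definition _ (R : finComPzRingType) (x : R) :=
  [isSub for @principal_val R x].
HB.instance Definition _ (R : finComPzRingType) (x : R) :=
  [Choice of principal_module x by <:].
HB.instance Definition _ (R : finComPzRingType) (x : R) :=
  GRing.SubChoice_isSubLmodule.Build R R^o (principal_ideal x)
    (principal_module x) (principal_ideal_closed x).

(* Self-injectivity extends the well defined map [a * x |-> a * y] from the
   ideal generated by [x] to all of [R]. *)
Lemma frobenius_ann_sub (R : finComPzRingType) (hR : frobenius_ring R)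
    (x y : R) :
  (forall r : R, r * x = 0 -> r * y = 0) -> exists c : R, y = c * x.
Proof.
move=> annxy.
have ex (z : principal_module x) : exists a : R, (val z : R) == a * x.
  by case: z => z zP; apply/existsP: zP.
have ann_eq (a c : R) : a * x = c * x -> a * y = c * y.
  move=> eq_ac; apply/eqP; rewrite -subr_eq0 -mulrBl; apply/eqP/annxy.
  by rewrite mulrBl eq_ac subrr.
pose h (z : principal_module x) : R^o := xchoose (ex z) * y.
have hE (z : principal_module x) (a : R) :
    (val z : R) = a * x -> h z = a * y.
  by move=> za; apply: ann_eq; rewrite -za; apply/esym/eqP/(xchooseP (ex z)).
have h_lin : linear h.
  move=> r u v; rewrite [h (r *: u + v)](hE _ (r * xchoose (ex u) + xchoose (ex v))).
    by rewrite mulrDl -mulrA.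
  rewrite linearP mulrDl -mulrA.
  by rewrite -(eqP (xchooseP (ex u))) -(eqP (xchooseP (ex v))).
pose hL : {linear principal_module x -> R^o} :=
  HB.pack h (GRing.isLinear.Build R (principal_module x) R^o *:%R h h_lin).
have [k kE] := hR _ _ (\val : {linear principal_module x -> R^o}) hL val_inj.
have xP : (x : R^o) \in principal_ideal x.
  by apply/existsP; exists 1; rewrite mul1r.
(* The extension [k] is linear on [R^o], so y = h(x) = k(x * 1) = x * k(1). *)
exists (k 1).
have := kE (PrincipalModule xP); rewrite /= (hE _ 1) ?mul1r // => <-.
rewrite /= -[X in k X](mulr1 (x : R)).
by rewrite -[X in k X]/((x : R) *: (1 : R^o)) linearZ /= mulrC.
Qed.

(** * Counting sums and images of additive subgroups *)

(** All nonempty fibres of (a, w) |-> a + f w on A x B have the same size: the fibre through (a, c)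
    consists of the pairs (a - f w, c + w) with w in B and f w in A. *)
Lemma card_add_image (V W : finZmodType) (f : W -> V)
    (fB : {morph f : u v / u - v}) (A : {set V}) (B : {set W}) :
  GRing.zmod_closed (mem A) -> GRing.zmod_closed (mem B) ->
  (#|[set (p.1 + f p.2)%R | p in setX A B]| * #|[set w in B | f w \in A]| =
   #|A| * #|B|)%N.
Proof.
move=> [A0 Asub] [B0 Bsub].
have Aopp a : a \in A -> - a \in A.
  by move=> Aa; rewrite -sub0r; apply: Asub.
have Bopp a : a \in B -> - a \in B.
  by move=> Aa; rewrite -sub0r; apply: Bsub.
have fD u v : f (u + v) = f u + f v.
  by rewrite -[in LHS](opprK v) -[- v]sub0r !fB -[in f 0](subrr 0) fB subrr sub0r opprK.
rewrite -[RHS]cardsX -[RHS]sum1_card (partition_big_imset (fun p => p.1 + f p.2)) /=.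
rewrite -sum_nat_const; apply: eq_bigr => _ /imsetP[[a c] /setXP[/= Aa Bc] ->].
rewrite sum1dep_card.
have inj : injective (fun w : W => (a - f w, c + w)).
  by move=> w w' [_ /addrI].
rewrite -(card_imset _ inj); apply: eq_card => -[u v]; rewrite !inE /=.
apply/imsetP/andP => [[w]|[/andP[Au Bv] /eqP uv]].
  rewrite inE => /andP[Bw Afw] [-> ->]; split; last first.
    by rewrite fD /= addrA (addrAC a) addrNK.
  apply/andP; split; first exact: Asub.
  by rewrite -[w]opprK; apply: Bsub => //; apply: Bopp.
exists (v - c); last first.
  by rewrite [c + _]addrC subrK fB opprB addrA -uv addrK.
rewrite inE Bsub //= fB.
have -> : f v - f c = a - u by apply/eqP; rewrite subr_eq addrAC -uv addrAC subrr add0r.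
exact: Asub.
Qed.

(* The case [A = 0] of [card_add_image]: the first isomorphism theorem. *)
Lemma card_image_ker (V W : finZmodType) (f : W -> V)
    (fB : {morph f : u v / u - v}) (B : {set W}) : GRing.zmod_closed (mem B) ->
  (#|f @: B| * #|[set w in B | f w == 0%R]| = #|B|)%N.
Proof.
move=> Bz; have Az : GRing.zmod_closed (mem [set 0 : V]).
  by split=> [|u v]; rewrite ?inE // => /eqP-> /eqP->; rewrite subrr.
have := card_add_image fB Az Bz; rewrite cards1 mul1n => <-.
congr (_ * _)%N; last by apply: eq_card => w; rewrite !inE.
apply: eq_card => v; apply/imsetP/imsetP => [[w Bw ->]|[[a w]]].
  by exists (0, w); rewrite ?inE ?eqxx //= add0r.
by rewrite !inE => /andP[/eqP /= -> Bw] ->; exists w; rewrite ?add0r.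
Qed.

(** * The annihilator of a maximal ideal *)

(** The hypothesis expresses maximality: every r outside m is invertible modulo m. It forces r x = 0
    to imply r in m for each nonzero x in [Ann]. By [frobenius_ann_sub], [Ann] then lies in R x, the
    image of r |-> r x, while m lies in the kernel of that map. *)
Lemma card_annihilator_max (R : finComPzRingType) (hR : frobenius_ring R)
    (m : {set R}) :
  (forall r, r \notin m -> exists s, 1 - s * r \in m) ->
  (#|[set x : R | [forall r in m, (r * x == 0)%R]]| * #|m| <= #|R|)%N.
Proof.
move=> max_m; set Ann := [set x | _].
have AnnP x : reflect (forall r, r \in m -> r * x = 0) (x \in Ann).
  rewrite inE; apply: (iffP forall_inP) => h r rm; apply/eqP; last by rewrite h.
  exact: h.
case: (pickP (fun x => (x \in Ann) && (x != 0))) => [x /andP[/AnnP Ax x0]|noA].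
  have ann_x r : r * x = 0 -> r \in m.
    move=> rx0; apply: contraNT x0 => /max_m[s /Ax].
    by rewrite mulrBl mul1r -mulrA rx0 mulr0 subr0 => ->.
  have Tz : GRing.zmod_closed (mem [set: R]) by split=> [|u v]; rewrite !inE.
  rewrite -cardsT -(card_image_ker (mulrBl x) Tz); apply: leq_mul.
    apply/subset_leq_card/subsetP => y /AnnP Ay.
    have [r /ann_x|c ->] := @frobenius_ann_sub R hR x y; first exact: Ay.
    by apply/imsetP; exists c.
  apply/subset_leq_card/subsetP => r rm; rewrite !inE /=.
  by apply/eqP; apply: Ax.
have -> : Ann = [set 0].
  apply/setP => x; rewrite [RHS]inE; have := noA x.
  case: eqP => [-> _|_]; last by rewrite andbT.
  by apply/AnnP => r _; rewrite mulr0.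
by rewrite cards1 mul1n max_card.
Qed.

(** * The inner product and the size of dual codes *)

Lemma inner_productB (R : finComPzRingType) (n b : nat)
    (u v w : 'M[R]_(n, b)) :
  inner_product u (v - w) = inner_product u v - inner_product u w.
Proof.
rewrite /inner_product -sumrB; apply: eq_bigr => i _.
by rewrite -sumrB; apply: eq_bigr => k _; rewrite !mxE mulrBr.
Qed.

Lemma inner_productZDl (R : finComPzRingType) (n b : nat) (r : R)
    (u v w : 'M[R]_(n, b)) :
  inner_product (r *: u + v) w = r * inner_product u w + inner_product v w.
Proof.
rewrite /inner_product mulr_sumr -big_split; apply: eq_bigr => i _ /=.
rewrite mulr_sumr -big_split; apply: eq_bigr => k _ /=.
by rewrite !mxE mulrDl mulrA.
Qed.

Lemma inner_productC (R : finComPzRingType) (n b : nat)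
    (u v : 'M[R]_(n, b)) : inner_product u v = inner_product v u.
Proof.
by apply: eq_bigr => i _; apply: eq_bigr => k _; rewrite mulrC.
Qed.

Lemma inner_product_delta (R : finComPzRingType) (n b : nat)
    (i : 'I_n) (k : 'I_b) (u : 'M[R]_(n, b)) :
  inner_product (delta_mx i k) u = u i k.
Proof.
rewrite /inner_product (bigD1 i) //= (bigD1 k) //= mxE !eqxx mul1r.
rewrite big1 => [|k' /negPf nk]; last by rewrite mxE nk andbF mul0r.
rewrite addr0 big1 ?addr0 // => i' /negPf ni.
by rewrite big1 // => k' _; rewrite mxE ni mul0r.
Qed.

Lemma dual_codeP (R : finComPzRingType) (n b : nat) (D : {set 'M[R]_(n, b)})
    (v : 'M[R]_(n, b)) :
  reflect (forall u, u \in D -> inner_product u v = 0) (v \in dual_code D).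
Proof.
rewrite inE; apply: (iffP forall_inP) => h u uD; apply/eqP; last by rewrite h.
exact: h.
Qed.

Lemma dual_code_closed (R : finComPzRingType) (n b : nat)
    (D : {set 'M[R]_(n, b)}) : byte_code (dual_code D).
Proof.
split=> [|r u v /dual_codeP Du /dual_codeP Dv]; apply/dual_codeP => w Dw.
  by rewrite -(subrr 0) inner_productB subrr.
by rewrite inner_productC inner_productZDl !(inner_productC _ w) Du // Dv // mulr0 addr0.
Qed.

(* [v] is chosen with [D + R v] minimal, so that the conductor
   [m = {r | r v in D}] is a maximal ideal.  Pairing with [v] embeds
   [D^perp / D'^perp] in the annihilator of [m], which has at most
   [#|R / m| = #|D' / D|] elements. *)
Lemma dual_code_step (R : finComPzRingType) (hR : frobenius_ring R)
    (n b : nat) (D E : {set 'M[R]_(n, b)}) :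
  byte_code D -> byte_code E -> D \proper E ->
  exists D' : {set 'M[R]_(n, b)}, [/\ byte_code D', D \proper D', D' \subset E &
    (#|D| * #|dual_code D| <= #|D'| * #|dual_code D'|)%N].
Proof.
move=> Dc Ec /properP[/subsetP DE [v0 v0E v0D]].
have [D0 Dlin] := Dc; have [E0 Elin] := Ec.
pose ext (v : 'M[R]_(n, b)) := [set p.1 + p.2 *: v | p in setX D [set: R]].
have extP v w : reflect (exists2 d, d \in D & exists r, w = d + r *: v) (w \in ext v).
  apply: (iffP imsetP) => [[[d r]]|[d Dd [r ->]]].
    by rewrite !inE andbT => /= Dd ->; exists d => //; exists r.
  by exists (d, r); rewrite ?inE ?Dd.
have Pv0 : (v0 \in E) && (v0 \notin D) by rewrite v0E.
case: (@arg_minnP _ v0 (fun v => (v \in E) && (v \notin D))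
  (fun v => #|ext v|) Pv0) => v /andP[vE vD] minv.
have DN u : u \in D -> - u \in D.
  by move=> uD; rewrite -[- u]addr0 -scaleN1r; apply: Dlin.
have DD u w : u \in D -> w \in D -> u + w \in D.
  by move=> uD wD; rewrite -[u]scale1r; apply: Dlin.
have DZ r u : u \in D -> r *: u \in D.
  by move=> uD; rewrite -[_ *: _]addr0; apply: Dlin.
have Dext w : D \subset ext w.
  by apply/subsetP => d Dd; apply/extP; exists d => //; exists 0; rewrite scale0r addr0.
have extv w : w \in ext w by apply/extP; exists 0 => //; exists 1; rewrite scale1r add0r.
have extc w : byte_code (ext w).
  split=> [|r _ _ /extP[d Dd [a ->]] /extP[d' Dd' [a' ->]]].
    exact: (subsetP (Dext w)).
  apply/extP; exists (r *: d + d'); first exact: Dlin.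
  exists (r * a + a'); rewrite scalerDr scalerDl scalerA.
  by rewrite addrACA.
pose m := [set r in [set: R] | r *: v \in D].
have max_m r : r \notin m -> exists s, 1 - s * r \in m.
  rewrite !inE /= => rvD.
  have rvE : r *: v \in E by rewrite -[_ *: _]addr0; apply: Elin.
  (* By minimality D + R(r v) is all of D + R v, so v = d + s r v with d in D, whence (1 - s r) v
     lies in D. *)
  have sub : ext (r *: v) \subset ext v.
    apply/subsetP => _ /extP[d Dd [a ->]]; apply/extP; exists d => //.
    by exists (a * r); rewrite scalerA.
  have /eqP eq_ext : ext (r *: v) == ext v.
    by rewrite eqEcard sub minv // rvE.
  have := extv v; rewrite -eq_ext => /extP[d Dd [s vE']].
  exists s; rewrite !inE /= scalerBl scale1r -scalerA {1}vE' addrK //.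
exists (ext v); split=> //.
- apply/properP; split=> //; by exists v.
- apply/subsetP => _ /extP[d Dd [r ->]]; rewrite addrC.
  by apply: Elin => //; apply: DE.
have fB : {morph (fun r : R => r *: v) : u w / u - w} by move=> r s; rewrite scalerBl.
have Dz : GRing.zmod_closed (mem D) by split=> // u w uD wD; apply: DD => //; apply: DN.
have Tz : GRing.zmod_closed (mem [set: R]) by split=> [|u w]; rewrite !inE.
have cD := card_add_image fB Dz Tz; rewrite -/(ext v) -/m cardsT in cD.
have gB : {morph inner_product v : u w / u - w} by move=> u w; rewrite inner_productB.
have Pz : GRing.zmod_closed (mem (dual_code D)).
  have [P0 Plin] := dual_code_closed D; split=> // u w uP wP.
  by rewrite -[w]scale1r -scaleNr addrC; apply: Plin.
have cP := card_image_ker gB Pz.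
set Ann := [set x : R | [forall r in m, (r * x == 0)%R]].
have leAnn : (#|inner_product v @: dual_code D| <= #|Ann|)%N.
  apply/subset_leq_card/subsetP => _ /imsetP[u /dual_codeP uP ->].
  rewrite inE; apply/forall_inP => r; rewrite !inE /= => rvD.
  have := uP _ rvD; rewrite -[r *: v]addr0 inner_productZDl.
  by rewrite (uP 0) // addr0 => ->.
have leK : (#|[set w in dual_code D | (inner_product v w == 0)%R]| <=
            #|dual_code (ext v)|)%N.
  apply/subset_leq_card/subsetP => u; rewrite inE => /andP[/dual_codeP uP /eqP vu].
  apply/dual_codeP => _ /extP[d Dd [r ->]].
  by rewrite addrC inner_productZDl vu mulr0 add0r uP.
have leR := card_annihilator_max hR max_m; rewrite -/Ann in leR.
have R0 : (0 < #|R|)%N by apply/card_gt0P; exists 0.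
(* After multiplication by [#|R|], [cD] and [cP] turn the left side into [#|ext v| * #|m|] times the
   sizes of the image and kernel of the pairing with v on [dual_code D]. These are bounded by
   [leAnn] and [leK], and [leR] absorbs [#|m| * #|Ann|]. *)
rewrite -(leq_pmul2r R0) -cP mulnAC -cD.
apply: leq_trans (_ : #|ext v| * #|m| * (#|Ann| * #|dual_code (ext v)|) <= _)%N.
  by rewrite leq_mul2l leq_mul // orbT.
by rewrite [(#|Ann| * _)%N]mulnC mulnACA [(#|m| * _)%N]mulnC leq_mul2l leR orbT.
Qed.

Lemma dual_code_card_mono (R : finComPzRingType) (hR : frobenius_ring R)
    (n b : nat) (D E : {set 'M[R]_(n, b)}) :
  byte_code D -> byte_code E -> D \subset E ->
  (#|D| * #|dual_code D| <= #|E| * #|dual_code E|)%N.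
Proof.
have [k] := ubnP (#|E| - #|D|); elim: k D => // k IH D ltk Dc Ec DE.
have [-> //|neDE] := eqVneq D E.
have pDE : D \proper E by rewrite properEneq neDE.
have [D' [Dc' pDD' D'E le]] := dual_code_step hR Dc Ec pDE.
apply: (leq_trans le); apply: IH => //.
rewrite ltnS in ltk; apply: leq_trans ltk.
by apply: ltn_sub2l; apply: proper_card.
Qed.

Lemma card_dual_code (R : finComPzRingType) (hR : frobenius_ring R)
    (n b : nat) (D : {set 'M[R]_(n, b)}) : byte_code D ->
  (#|D| * #|dual_code D|)%N = #|{: 'M[R]_(n, b)}|.
Proof.
move=> Dc; have [D0 _] := Dc.
have Zc : byte_code [set 0 : 'M[R]_(n, b)].
  by split=> [|r u v]; rewrite !inE // => /eqP-> /eqP->; rewrite scaler0 addr0.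
have Tc : byte_code [set: 'M[R]_(n, b)] by split=> [|r u v]; rewrite !inE.
apply/eqP; rewrite eqn_leq; apply/andP; split.
  apply: leq_trans (dual_code_card_mono hR Dc Tc (subsetT _)) _.
  (* Nondegeneracy: pairing with [delta_mx i k] reads off the entry (i, k). *)
  have -> : dual_code [set: 'M[R]_(n, b)] = [set 0].
    apply/setP => u; rewrite [RHS]inE; apply/dual_codeP/eqP => [uT|-> v _].
      apply/matrixP => i k.
      by rewrite mxE -inner_product_delta uT ?inE.
    by rewrite -(subrr 0) inner_productB subrr.
  by rewrite cards1 muln1 cardsT.
have := dual_code_card_mono hR Zc Dc; rewrite sub1set => /(_ D0).
apply: leq_trans; rewrite cards1 mul1n -cardsT; apply/subset_leq_card/subsetP => u _.
by apply/dual_codeP => _ /set1P ->; rewrite inner_productC -(subrr 0) inner_productB subrr.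
Qed.

(** * Codes and prescribed zero coordinates *)

Definition vanishing_on (R : finComPzRingType) (n b : nat)
    (S : {set 'I_n * 'I_b}) : {set 'M[R]_(n, b)} :=
  [set u : 'M_(n, b) | [forall q in S, u q.1 q.2 == 0]].

Lemma vanishing_onP (R : finComPzRingType) (n b : nat)
    (S : {set 'I_n * 'I_b}) (u : 'M[R]_(n, b)) :
  reflect (forall q, q \in S -> u q.1 q.2 = 0) (u \in vanishing_on R S).
Proof.
rewrite inE; apply: (iffP forall_inP) => h q qS; apply/eqP; last by rewrite h.
exact: h.
Qed.

Lemma card_vanishing_on (R : finComPzRingType) (n b : nat)
    (S : {set 'I_n * 'I_b}) : #|vanishing_on R S| = (#|R| ^ #|~: S|)%N.
Proof.
(* Through [mx_val], the matrices vanishing on S become the finite functions on index pairs with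
   support in [~: S]. *)
rewrite -(card_pffun_on (0 : R) (mem (~: S)) predT).
rewrite -(card_imset _ (val_inj : injective (@mx_val R n b))).
apply: eq_card => f; apply/imsetP/pffun_onP => [[u /vanishing_onP uS ->]|[fS _]].
  split=> //; apply/subsetP => -[i k]; rewrite !inE /=; apply: contraNN => qS.
  by rewrite -[val u (i, k)]/(u i k) (uS (i, k)).
exists (\matrix_(i, k) f (i, k)).
  apply/vanishing_onP => q qS; rewrite mxE -surjective_pairing; apply/eqP.
  by apply: contraLR qS => /(subsetP fS); rewrite inE.
by apply/ffunP => -[i k]; rewrite -[RHS]/((\matrix_(i, k) f (i, k)) i k) mxE.
Qed.

Lemma vanishing_on_closed (R : finComPzRingType) (n b : nat)
    (S : {set 'I_n * 'I_b}) : byte_code (vanishing_on R S).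
Proof.
split=> [|r u v /vanishing_onP uS /vanishing_onP vS]; apply/vanishing_onP => q qS.
  by rewrite mxE.
by rewrite !mxE uS // vS // mulr0 addr0.
Qed.

Lemma byte_code_zmod_closed (R : finComPzRingType) (n b : nat)
    (D : {set 'M[R]_(n, b)}) : byte_code D -> GRing.zmod_closed (mem D).
Proof. by move=> Dc; apply: GRing.submod_closedB. Qed.

(* Duality applied to [C + V_(~: S)], whose dual is [C^perp :&: V_S], where
   [V_S] consists of the vectors supported in [S]. *)
Lemma card_dual_code_vanishing (R : finComPzRingType) (hR : frobenius_ring R)
    (n b : nat) (C : {set 'M[R]_(n, b)}) (hC : byte_code C)
    (S : {set 'I_n * 'I_b}) :
  (#|C| * #|dual_code C :&: vanishing_on R (~: S)| =
   #|R| ^ #|S| * #|C :&: vanishing_on R S|)%N.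
Proof.
(* Vanishing on S means being supported in [~: S], so [Z] is V_(~: S). The [id] in [D] matches the
   image set of [card_add_image]. *)
pose Z := vanishing_on R S.
have [[C0 Clin] Zc] := (hC, vanishing_on_closed R S); have [Z0 Zlin] := Zc.
pose D : {set 'M[R]_(n, b)} := [set p.1 + id p.2 | p in setX C Z].
have DP w : reflect (exists2 c, c \in C & exists2 z, z \in Z & w = c + z) (w \in D).
  apply: (iffP imsetP) => [[[c z]]|[c cC [z zZ ->]]].
    by rewrite inE => /andP[/= cC zZ] ->; exists c => //; exists z.
  by exists (c, z); rewrite // inE cC.
have Dc : byte_code D.
  split=> [|r _ _ /DP[c cC [z zZ ->]] /DP[c' cC' [z' zZ' ->]]]; apply/DP.
    by exists 0 => //; exists 0; rewrite ?addr0.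
  exists (r *: c + c'); first exact: Clin.
  exists (r *: z + z'); first exact: Zlin.
  by rewrite scalerDr addrACA.
have dualD : dual_code D = dual_code C :&: vanishing_on R (~: S).
  apply/setP => v; rewrite [RHS]in_setI.
  apply/dual_codeP/andP => [vD|[/dual_codeP vC /vanishing_onP vS] _ /DP[c cC [z /vanishing_onP zZ ->]]].
    split.
      by apply/dual_codeP => c cC; apply: vD; apply/DP; exists c => //; exists 0; rewrite ?addr0.
    apply/vanishing_onP => -[i k]; rewrite inE => qS /=.
    rewrite -inner_product_delta vD //.
    apply/DP; exists 0 => //; exists (delta_mx i k); last by rewrite add0r.
    apply/vanishing_onP => -[i' k'] q'S /=; rewrite mxE.
    by case: eqP => // ei; case: eqP => // ek; rewrite ei ek (negPf qS) in q'S.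
  rewrite -[c]scale1r inner_productZDl vC // mulr0 add0r.
  rewrite /inner_product big1 // => i _; rewrite big1 // => k _.
  have [qS|qS] := boolP ((i, k) \in S); first by rewrite (zZ (i, k)) // mul0r.
  by rewrite (vS (i, k)) ?mulr0 // inE.
have idB : {morph (@id 'M[R]_(n, b)) : u v / u - v} by [].
have cD := card_add_image idB (byte_code_zmod_closed hC) (byte_code_zmod_closed Zc).
rewrite -/D in cD.
have := card_dual_code hR Dc; rewrite dualD -cardsT => cV.
have eT : [set: 'M[R]_(n, b)] = vanishing_on R set0.
  by apply/setP => u; rewrite inE; apply/esym/vanishing_onP => q; rewrite inE.
have R0 : (0 < #|R|)%N by apply/card_gt0P; exists 0.
have Zgt0 : (0 < #|Z|)%N by apply/card_gt0P; exists 0.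
have eV : #|[set: 'M[R]_(n, b)]| = (#|Z| * #|R| ^ #|S|)%N.
  by rewrite eT !card_vanishing_on -expnD setC0 cardsT addnC cardsC.
have eI : [set w in Z | id w \in C] = C :&: Z.
  by apply/setP => w; rewrite !inE andbC.
rewrite eI in cD.
(* The factor [#|Z|] is restored in order to combine |C| |Z| = |D| |C :&: Z| with |D| |D^perp| = |Z|
   |R|^|S|. *)
apply/eqP; rewrite -(eqn_pmul2l Zgt0) mulnA [(#|Z| * #|C|)%N]mulnC -cD.
by rewrite mulnAC cV eV mulnA.
Qed.

(** * MacWilliams identity for coordinatewise weights *)

(** With l = [#|R|], a factor on the dual side is y + [u_q = 0](x - y), and one on the code side is
    [u_q = 0] l y + (x - y). Expanding both with J the set of coordinates contributing y or l y, the
    two sides carry the same coefficient [W J], so [card_dual_code_vanishing] matches them term by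
    term. *)
Lemma macwilliams_prod (R : finComPzRingType) (hR : frobenius_ring R)
    (n b : nat) (C : {set 'M[R]_(n, b)}) (hC : byte_code C)
    (A : comNzRingType) (x y : 'I_n * 'I_b -> A) :
  #|C|%:R * (\sum_(u in dual_code C)
     \prod_q (if u q.1 q.2 == 0 then x q else y q)) =
  \sum_(u in C) \prod_q
     (if u q.1 q.2 == 0 then x q + (#|R|%:R - 1) * y q else x q - y q).
Proof.
pose W (J : {set 'I_n * 'I_b}) := \prod_q (if q \in J then y q else x q - y q).
have count (E : {set 'M[R]_(n, b)}) S :
    \sum_(u in E) (u \in vanishing_on R S)%:R = #|E :&: vanishing_on R S|%:R :> A.
  by rewrite -natr_sum -big_mkcondr sum1dep_card; congr _%:R; apply: eq_card => u; rewrite !inE.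
have dualE (u : 'M[R]_(n, b)) : \prod_q (if u q.1 q.2 == 0 then x q else y q) =
    \sum_J W J * (u \in vanishing_on R (~: J))%:R.
  rewrite (eq_bigr (fun q => y q + (if u q.1 q.2 == 0 then x q - y q else 0))).
    rewrite bigA_distr; apply: eq_bigr => J _.
    case: vanishing_onP => [uJ|nuJ].
      rewrite mulr1; apply: eq_bigr => q _; case: ifPn => // qJ.
      by rewrite uJ ?eqxx // inE.
    have [q /andP[qJ uq]] : exists q, (q \notin J) && (u q.1 q.2 != 0).
      apply/existsP; apply: contraT => /existsPn h; case: nuJ => q.
      by rewrite inE => qJ; apply/eqP; have := h q; rewrite qJ negbK.
    by rewrite mulr0 (bigD1 q) //= (negPf qJ) (negPf uq) mul0r.
  by move=> q _; case: ifP => _; rewrite ?addr0 // addrC subrK.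
have codeE (u : 'M[R]_(n, b)) : \prod_q (if u q.1 q.2 == 0 then x q + (#|R|%:R - 1) * y q
                        else x q - y q) =
    \sum_J W J * (#|R| ^ #|J|)%:R * (u \in vanishing_on R J)%:R.
  rewrite (eq_bigr (fun q => (if u q.1 q.2 == 0 then #|R|%:R * y q else 0)
                             + (x q - y q))).
    rewrite bigA_distr; apply: eq_bigr => J _.
    case: vanishing_onP => [uJ|nuJ].
      rewrite mulr1 mulrC natrX -prodr_const [\prod_(_ in _) _]big_mkcond.
      rewrite -big_split; apply: eq_bigr => q _ /=; case: ifPn => qJ.
        by rewrite uJ ?eqxx.
      by rewrite mul1r.
    have [q /andP[qJ uq]] : exists q, (q \in J) && (u q.1 q.2 != 0).
      apply/existsP; apply: contraT => /existsPn h; case: nuJ => q.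
      by move=> qJ; apply/eqP; have := h q; rewrite qJ negbK.
    by rewrite mulr0 (bigD1 q) //= qJ (negPf uq) mul0r.
  move=> q _; case: ifP => _; last by rewrite add0r.
  by rewrite mulrBl mul1r addrCA.
rewrite (eq_bigr _ (fun u _ => dualE u)) exchange_big /=.
rewrite [RHS](eq_bigr _ (fun u _ => codeE u)) [RHS]exchange_big /=.
rewrite mulr_sumr.
apply: eq_bigr => J _; rewrite -!mulr_sumr !count mulrCA -mulrA -!natrM.
by rewrite card_dual_code_vanishing.
Qed.

(** * Krawtchouk numbers as sums over subsets *)

Lemma coef_expr_1addZX (A : comNzRingType) (c : A) (m i : nat) :
  ((1 + c *: 'X) ^+ m)`_i = c ^+ i * 'C(m, i)%:R.
Proof.
have -> : (1 + c *: 'X) ^+ m = \poly_(j < m.+1) (c ^+ j * 'C(m, j)%:R).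
  rewrite exprDn poly_def; apply: eq_bigr => j _.
  by rewrite expr1n mul1r exprZn mulr_natr scalerMnl.
rewrite coef_poly ltnS; case: leqP => // lt_mi.
by rewrite bin_small ?mulr0.
Qed.

(* Both sides are the coefficient of 'X^p in
   (1 - 'X)^#|S| * (1 + (l - 1) 'X)^(b - #|S|). *)
Lemma krawtchouk_subsets (l b p : nat) (S : {set 'I_b}) :
  \sum_(T : {set 'I_b} | #|T| == p)
    \prod_(k in T) (if k \in S then -1 else l%:Z - 1) = krawtchouk l b p #|S|.
Proof.
pose kap (k : 'I_b) : int := if k \in S then -1 else l%:Z - 1.
pose P : {poly int} := \prod_k (1 + kap k *: 'X).
transitivity P`_p.
  have -> : P = \sum_(T : {set 'I_b}) (\prod_(k in T) kap k) *: 'X^#|T|.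
    rewrite /P (eq_bigr (fun k => kap k *: 'X + 1)) => [|k _]; last exact: addrC.
    rewrite bigA_distr; apply: eq_bigr => T _.
    by rewrite -big_mkcond /= scaler_prod prodr_const.
  rewrite coef_sum big_mkcond; apply: eq_bigr => T _.
  by rewrite coefZ coefXn eq_sym; case: eqP; rewrite ?mulr1 ?mulr0.
have -> : P = (1 + (-1) *: 'X) ^+ #|S| * (1 + (l%:Z - 1) *: 'X) ^+ (b - #|S|).
  rewrite /P (bigID (mem S)) /=; congr (_ * _).
    by rewrite -prodr_const; apply: eq_bigr => k kS; rewrite /kap kS.
  have -> : (b - #|S|)%N = #|~: S| by rewrite -[X in (X - _)%N]card_ord -(cardsC S) addKn.
  rewrite -prodr_const; apply: eq_big => [k|k /negPf kS]; first by rewrite inE.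
  by rewrite /kap kS.
rewrite coefM /krawtchouk big_mkord; apply: eq_bigr => a _.
by rewrite !coef_expr_1addZX !natz mulrACA mulrA.
Qed.

(** Grouping the sets T by size reduces this to [krawtchouk_subsets], mapped from the integers to A.
    It turns a sum over the possible supports T of one byte into a sum over weights p. *)
Lemma krawtchouk_weighted_subsets (A : comNzRingType) (l b : nat)
    (S : {set 'I_b}) (c : nat -> A) :
  \sum_(T : {set 'I_b})
    c #|T| * \prod_(k in T) (if k \in S then -1 else l%:R - 1) =
  \sum_(0 <= p < b.+1) (krawtchouk l b p #|S|)%:~R * c p.
Proof.
have cT (T : {set 'I_b}) : (#|T| < b.+1)%N by rewrite ltnS -[leqRHS]card_ord max_card.
rewrite (partition_big (fun T => Ordinal (cT T)) predT) //= big_mkord.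
apply: eq_bigr => p _; rewrite -krawtchouk_subsets rmorph_sum mulr_suml /=.
apply: eq_big => [T|T /eqP <-] //=; rewrite mulrC rmorph_prod; congr (_ * _).
apply: eq_bigr => k _; case: ifP => _; first by rewrite rmorphN1.
by rewrite rmorphB rmorph1 /= -pmulrn.
Qed.

(** * Byte weights and the split enumerator *)

(** A function of byte weights need not be a product over coordinates, but the indicator of a fixed
    support pattern T is one. Applying [macwilliams_prod] to each indicator and summing with
    coefficients [G T] gives the result. *)
Lemma macwilliams_byte_weights (R : finComPzRingType) (hR : frobenius_ring R)
    (n b : nat) (C : {set 'M[R]_(n, b)}) (hC : byte_code C)
    (A : comNzRingType) (c : 'I_n -> nat -> A) :
  #|C|%:R * (\sum_(u in dual_code C)
     \prod_i c i (hamming_weight (row i u))) =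
  \sum_(u in C) \prod_i \sum_(0 <= p < b.+1)
     (krawtchouk #|R| b p (hamming_weight (row i u)))%:~R * c i p.
Proof.
pose supp (u : 'M[R]_(n, b)) i := [set k | u i k != 0].
have suppE u i : hamming_weight (row i u) = #|supp u i|.
  by apply: eq_card => k; rewrite !inE mxE.
(* With these weights the product over q is 1 if u has support pattern T, and 0 otherwise. *)
pose ex (T : {ffun 'I_n -> {set 'I_b}}) (q : 'I_n * 'I_b) : A := (q.2 \notin T q.1)%:R.
pose ey (T : {ffun 'I_n -> {set 'I_b}}) (q : 'I_n * 'I_b) : A := (q.2 \in T q.1)%:R.
pose G (T : {ffun 'I_n -> {set 'I_b}}) := \prod_i c i #|T i|.
have dualE (u : 'M[R]_(n, b)) : \prod_i c i (hamming_weight (row i u)) =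
    \sum_T G T * \prod_q (if u q.1 q.2 == 0 then ex T q else ey T q).
  pose F i (T : {set 'I_b}) :=
    c i #|T| * \prod_k (if u i k == 0 then (k \notin T)%:R else (k \in T)%:R).
  transitivity (\prod_i \sum_T F i T).
    apply: eq_bigr => i _; rewrite (bigD1 (supp u i)) //= suppE {1}/F.
    rewrite big1 ?mulr1 => [|k _]; last by rewrite !inE; case: eqP.
    rewrite big1 ?addr0 // => T nT; rewrite /F.
    have [k uk] : exists k, (k \in T) != (k \in supp u i).
      apply/existsP; apply: contraNT nT => /existsPn h; apply/eqP/setP => k.
      by apply/eqP; have := h k; rewrite negbK.
    rewrite (bigD1 k) //=; move: uk; rewrite inE.
    by case: (u i k == 0); case: (k \in T) => //= _; rewrite mul0r mulr0.
  rewrite bigA_distr_bigA; apply: eq_bigr => T _.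
  rewrite big_split; congr (_ * _).
  by rewrite (pair_bigA _ (fun i k =>
    if u i k == 0 then (k \notin T i)%:R else (k \in T i)%:R)).
have codeE (u : 'M[R]_(n, b)) : \prod_i \sum_(0 <= p < b.+1)
       (krawtchouk #|R| b p (hamming_weight (row i u)))%:~R * c i p =
    \sum_T G T * \prod_q (if u q.1 q.2 == 0 then ex T q + (#|R|%:R - 1) * ey T q
                          else ex T q - ey T q).
  pose F i (T : {set 'I_b}) :=
    c i #|T| * \prod_(k in T) (if k \in supp u i then -1 else #|R|%:R - 1).
  transitivity (\prod_i \sum_T F i T).
    by apply: eq_bigr => i _; rewrite suppE -krawtchouk_weighted_subsets.
  rewrite bigA_distr_bigA; apply: eq_bigr => T _.
  rewrite big_split; congr (_ * _).
  rewrite -(pair_bigA _ (fun i k =>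
    if u i k == 0 then ex T (i, k) + (#|R|%:R - 1) * ey T (i, k)
    else ex T (i, k) - ey T (i, k))) /=.
  apply: eq_bigr => i _; rewrite big_mkcond; apply: eq_bigr => k _ /=.
  (* The transformed factor is 1 off T; on T it is l - 1 where u vanishes and -1 elsewhere. *)
  rewrite /ex /ey inE /=; case: eqP => _; case: (k \in T i) => //=.
  - by rewrite add0r mulr1.
  - by rewrite mulr0 addr0.
  - by rewrite sub0r.
  - by rewrite subr0.
rewrite (eq_bigr _ (fun u _ => dualE u)) exchange_big /=.
rewrite [RHS](eq_bigr _ (fun u _ => codeE u)) [RHS]exchange_big /=.
rewrite mulr_sumr; apply: eq_bigr => T _.
by rewrite -!mulr_sumr mulrCA macwilliams_prod.
Qed.

Lemma hamming_weight_lt (R : finComPzRingType) (b : nat) (u : 'rV[R]_b) :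
  (hamming_weight u < b.+1)%N.
Proof. by rewrite ltnS -[leqRHS]card_ord max_card. Qed.

Theorem theorem5p2 (R : finComPzRingType) (hR : frobenius_ring R)
    (b n t : nat) (hb : (1 <= b)%N) (hn : (1 <= n)%N)
    (ht1 : (1 <= t)%N) (htb : (t <= b)%N)
    (C : {set 'M[R]_(n, b)}) (hC : byte_code C) :
  split_enumerator t (dual_code C) =
    (#|C|%:R : rat)^-1 *:
      \sum_(j : {ffun 'I_n -> 'I_b.+1})
        (weight_count C j)%:R *
          \prod_(i < n) g_poly #|R| b t (j i) (xvar i) (yvar i).
Proof.
(* For this [c] the inner sum over p in [macwilliams_byte_weights] is [g_poly]. *)
pose c (i : 'I_n) (p : nat) : {mpoly rat[n + n]} :=
  xvar i ^+ (ceil_div b t - ceil_div p t) * yvar i ^+ ceil_div p t.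
have C0 : (#|C|%:R : rat) != 0.
  by have [C0 _] := hC; rewrite Num.Theory.pnatr_eq0 -lt0n; apply/card_gt0P; exists 0.
pose jv (u : 'M[R]_(n, b)) : {ffun 'I_n -> 'I_b.+1} :=
  [ffun i => Ordinal (hamming_weight_lt (row i u))].
transitivity ((#|C|%:R : rat)^-1 *: (#|C|%:R * split_enumerator t (dual_code C))).
  by rewrite mulr_natl -scaler_nat scalerA mulVf // scale1r.
congr (_ *: _); rewrite -[split_enumerator _ _]/(\sum_(u in dual_code C)
  \prod_i c i (hamming_weight (row i u))) macwilliams_byte_weights //.
(* Codewords are grouped by weight distribution vector; the summand is constant on the class of j,
   which has [weight_count C j] elements. *)
rewrite (partition_big jv predT) //=; apply: eq_bigr => j _.
rewrite mulr_natl -sumr_const; apply: eq_big => [u|u /andP[_ /eqP <-]].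
  rewrite inE; congr (_ && _); apply/eqP/forallP => [<- i|wu]; first by rewrite ffunE.
  by apply/ffunP => i; apply/val_inj; rewrite ffunE /=; apply/eqP/wu.
apply: eq_bigr => i _; rewrite /g_poly ffunE /=.
by apply: eq_bigr => p _; rewrite mulrA.
Qed.
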